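(* For $\omega\in\mathfrak{B}_n$ chosen uniformly at random, with high probability $\alpha(\omega)=\Theta(n^3)$ and $\beta(\omega)=\Theta(n^3)$; that is, for every sequence $h(n)\to\infty$ of positive reals, $$\mathbb{P}\left(\frac{n^3}{h(n)}\le\alpha(\omega)\le h(n)\,n^3\ \text{ and }\ \frac{n^3}{h(n)}\le\beta(\omega)\le h(n)\,n^3\right)\to1\qquad(n\to\infty).$$
   Context: $\mathfrak{S}_n$ is the set of permutations of $[n]=\{1,\dots,n\}$, in one-line notation. A reduction of $\omega\in\mathfrak{S}_n$ interchanges $\omega(i)$ and $\omega(j)$ for some $i<j$ with $\omega(i)>\omega(j)$. Bruhat order: $\pi\le\sigma$ if $\pi$ is obtained from $\sigma$ by a (possibly empty) sequence of reductions. $\mathfrak{B}_n\subseteq\mathfrak{S}_n$ is the set of bigrassmannian permutations, i.e. those $\omega$ such that both $\omega$ and $\omega^{-1}$ have exactly one descent; equivalently $\omega=1\cdots a\,(b+1)\cdots c\,(a+1)\cdots b\,(c+1)\cdots n$ for some $0\le a<b<c\le n$. For $\omega\in\mathfrak{B}_n$, $\beta(\omega)$ is the number of $\pi\in\mathfrak{B}_n$ with $\pi\le\omega$, and $\alpha(\omega)$ is the number of $\tau\in\mathfrak{B}_n$ with $\omega\le\tau$. *)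

(* Defs.v *)
From HB Require Import structures.
From mathcomp Require Import all_boot all_order all_fingroup all_algebra.
From mathcomp Require Import all_classical all_reals all_analysis.

Set Implicit Arguments.
Unset Strict Implicit.
Unset Printing Implicit Defensive.

Import Order.TTheory GRing.Theory Num.Theory.
Import numFieldNormedType.Exports.

(* Permutations of [n] are elements of 'S_n, i.e. permutations of
   {0, ..., n-1}. *)

(* As (s * t)%g x = t (s x), the permutation (tperm i j * s)%g has the one-line
   notation of s with the entries at positions i and j interchanged. *)
Definition reduction (n : nat) (s p : 'S_n) : bool :=
  [exists i : 'I_n, exists j : 'I_n,
    [&& (i < j)%N, (s j < s i)%N & p == (tperm i j * s)%g]].

Definition bruhat_le (n : nat) (p s : 'S_n) : bool :=
  connect (@reduction n) s p.

Definition descents (n : nat) (s : 'S_n) : {set 'I_n} :=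
  [set i : 'I_n | [exists j : 'I_n, (j == i.+1 :> nat) && (s j < s i)%N]]%SET.

Definition bigrassmannian (n : nat) : {set 'S_n} :=
  [set s : 'S_n | (#|descents s| == 1%N) && (#|descents s^-1%g| == 1%N)]%SET.

Definition beta (n : nat) (w : 'S_n) : nat :=
  #|[set p in bigrassmannian n | bruhat_le p w]%SET|.

Definition alpha (n : nat) (w : 'S_n) : nat :=
  #|[set t in bigrassmannian n | bruhat_le w t]%SET|.

(* Probability of the event E for a uniformly random element of A; it takes the
   junk value 0 when A is empty. *)
Definition uniform_on (R : realType) (T : finType) (A : {set T})
    (E : pred T) : R :=
  (#|[set x in A | E x]%SET|%:R / #|A|%:R)%R.

(* Main.v *)
(* Write [blk n a p q] for the permutation exchanging two adjacent blocks of
   lengths q and p after a initial fixed points; with p = b - a > 0 and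
   q = c - b > 0 these are the bigrassmannian permutations, and there are of
   order n^3 of them. Moving the smallest or the largest entry of an exchanged
   block out of its block only uses reductions, so that
   [blk n (a + i + k) p q <= blk n a (p + i + j) (q + k)]. Hence if each of the
   four lengths a, p, q, n - (a + p + q) is at least 2m, there are at least m^3
   bigrassmannian permutations above and at least m^3 below [blk n a p q]. With
   m = n / K, all but a proportion O(1/K) of the bigrassmannian permutations have
   this property, uniformly in n, and K can be taken arbitrarily large. *)

Require Import Defs.
From HB Require Import structures.
From mathcomp Require Import all_boot all_order all_fingroup all_algebra.
From mathcomp Require Import all_classical all_reals all_analysis.
From mathcomp Require Import zify ring lra.

Set Implicit Arguments.
Unset Strict Implicit.
Unset Printing Implicit Defensive.

Import Order.TTheory GRing.Theory Num.Theory.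
Import numFieldNormedType.Exports.

(** * Block exchanges as permutations, and their descents *)

(* The one-line notation 1...a (b+1)...c (a+1)...b (c+1)...n with p = b - a and
   q = c - b, positions and values being shifted to start from 0. *)
Definition swap_blocks (a p q x : nat) : nat :=
  if x < a then x else if x < a + q then x + p
  else if x < a + q + p then x - q else x.

Lemma swap_blocks_lt (a p q x : nat) : x < a -> swap_blocks a p q x = x.
Proof. by rewrite /swap_blocks => ->. Qed.

Lemma swap_blocksD (a p q x : nat) :
  a <= x -> x < a + q -> swap_blocks a p q x = x + p.
Proof. by move=> le_ax lt_x; rewrite /swap_blocks ltnNge le_ax lt_x. Qed.

Lemma swap_blocksB (a p q x : nat) :
  a + q <= x -> x < a + q + p -> swap_blocks a p q x = x - q.
Proof.
by rewrite /swap_blocks => le_x ->; rewrite !ifF //; apply/negbTE; lia.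
Qed.

(* Only meaningful when a + p + q <= n. *)
Definition blk (n a p q : nat) : 'S_n :=
  odflt 1%g
    (insub [ffun x : 'I_n => insubd x (swap_blocks a p q x)] : option {perm 'I_n}).

Lemma blkE (n a p q : nat) (x : 'I_n) :
  a + p + q <= n -> blk n a p q x = swap_blocks a p q x :> nat.
Proof.
move=> le_n; rewrite /blk.
have gE (y : 'I_n) : insubd y (swap_blocks a p q y) = swap_blocks a p q y :> nat.
  rewrite val_insubd; case: ifP => // /negP[].
  by rewrite /swap_blocks; have := ltn_ord y; do !case: ifP; lia.
rewrite insubT /=; last first.
  move=> inj; rewrite -pvalE /= ffunE; exact: gE.
apply/injectiveP => y z; rewrite !ffunE => /(congr1 val) /=.
rewrite !gE => yz; apply: val_inj => /=; move: yz.
by rewrite /swap_blocks; do !case: ifP; lia.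
Qed.

Lemma blkV (n a p q : nat) :
  a + p + q <= n -> ((blk n a p q)^-1 = blk n a q p)%g.
Proof.
move=> le_n; apply: (mulgI (blk n a p q)); rewrite mulgV.
apply/permP => x; apply: val_inj; rewrite perm1 permM /= !blkE ?[a + q + p]addnAC //.
by rewrite /swap_blocks; do !case: ifP; lia.
Qed.

(** [a] is the first position that is moved, [p] is the shift there, and [a + q] is the next
    position where the shift changes. *)
Lemma blk_inj (n a p q a' p' q' : nat) :
  0 < p -> 0 < q -> 0 < p' -> 0 < q' ->
  a + p + q <= n -> a' + p' + q' <= n ->
  blk n a p q = blk n a' p' q' -> [/\ a = a', p = p' & q = q'].
Proof.
move=> p0 q0 p'0 q'0 le_n le_n' eq_blk.
have eq_sw x : x < n -> swap_blocks a p q x = swap_blocks a' p' q' x.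
  by move=> xn; rewrite -(blkE (Ordinal xn) le_n) -(blkE (Ordinal xn) le_n') eq_blk.
have ea : a = a'.
  case: (ltngtP a a') => // lt_a.
    by have := eq_sw a; rewrite swap_blocksD ?swap_blocks_lt //; lia.
  by have := eq_sw a'; rewrite swap_blocks_lt ?swap_blocksD //; lia.
subst a'; have : p = p'.
  by have := eq_sw a; rewrite !swap_blocksD //; lia.
split=> //; case: (ltngtP q q') => // lt_q.
  by have := eq_sw (a + q); rewrite swap_blocksB ?swap_blocksD //; lia.
by have := eq_sw (a + q'); rewrite swap_blocksD ?swap_blocksB //; lia.
Qed.

Lemma blk_descents (n a p q : nat) (x : 'I_n) :
  0 < p -> 0 < q -> a + p + q <= n ->
  (x \in descents (blk n a p q)) = (x.+1 == a + q).
Proof.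
move=> p0 q0 le_n; rewrite inE; apply/existsP/eqP => [[y /andP[/eqP yx]]|xE].
  by rewrite !blkE // /swap_blocks yx; do !case: ifP; lia.
have y_n : x.+1 < n by lia.
exists (Ordinal y_n); rewrite eqxx !blkE //= /swap_blocks.
by do !case: ifP; lia.
Qed.

Lemma card_descents_blk (n a p q : nat) :
  0 < p -> 0 < q -> a + p + q <= n -> #|descents (blk n a p q)| = 1.
Proof.
move=> p0 q0 le_n; have d_n : (a + q).-1 < n by lia.
apply/eqP/cards1P; exists (Ordinal d_n); apply/setP => x.
rewrite blk_descents // inE -val_eqE /=; lia.
Qed.

Lemma blk_bigrassmannian (n a p q : nat) :
  0 < p -> 0 < q -> a + p + q <= n -> blk n a p q \in bigrassmannian n.
Proof.
by move=> p0 q0 le_n; rewrite inE blkV // !card_descents_blk //; lia.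
Qed.

(** * Every bigrassmannian permutation is a block exchange *)

(** Positions on the same side of [d] are not separated by the descent, so every adjacent step
    between them is an ascent. *)
Lemma one_descent_homo (n : nat) (s : 'S_n) (d : 'I_n) :
  descents s = [set d]%SET ->
  forall x y : 'I_n, x < y -> (x <= d) = (y <= d) -> s x < s y.
Proof.
move=> sd x; have step (u v : 'I_n) : v = u.+1 :> nat -> u != d :> nat -> s u < s v.
  move=> vu ud; have : u \notin descents s by rewrite sd inE -val_eqE.
  rewrite inE negb_exists => /forallP/(_ v); rewrite vu eqxx /= -leqNgt.
  by rewrite leq_eqVlt => /orP[/eqP/val_inj/perm_inj uv|//]; move: vu; rewrite uv; lia.
case=> y /=; elim: y => //= y IHy y_n x_y xy_d.
have y_n' : y < n by lia.
have lt_y : s (Ordinal y_n') < s (Ordinal y_n) by apply: step => //=; lia.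
case: (ltnP x y) => [x_lt_y|y_le_x]; first by apply: (ltn_trans (IHy y_n' _ _)); lia.
suff -> : x = Ordinal y_n' by [].
by apply: val_inj => /=; lia.
Qed.

Lemma card_ord_lt (n m : nat) : m <= n -> #|[set y : 'I_n | y < m]%SET| = m.
Proof.
by move=> le_mn; rewrite -sum1dep_card (big_ord_narrow le_mn) sum_nat_const card_ord muln1.
Qed.

(** A member [x] brings [x.+1] members with it, while a nonmember [x] leaves room only for the
    positions below it. Block boundaries are read off as such cardinals. *)
Lemma down_closed_ord (n : nat) (S : {set 'I_n}) :
  (forall x y : 'I_n, x < y -> y \in S -> x \in S) ->
  forall x : 'I_n, (x \in S) = (x < #|S|).
Proof.
move=> dcl x; have ltx := ltn_ord x; case: (boolP (x \in S)) => [xS|xNS].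
  rewrite -{1}(card_ord_lt ltx) subset_leq_card //.
  apply/fintype.subsetP => y; rewrite inE ltnS leq_eqVlt => /orP[/eqP/val_inj -> //|yx].
  exact: dcl xS.
apply/esym/negbTE; rewrite -leqNgt -[leqRHS](card_ord_lt (ltnW ltx)) subset_leq_card //.
apply/fintype.subsetP => y yS; rewrite inE ltnNge; apply: contra xNS.
by rewrite leq_eqVlt => /orP[/eqP/val_inj -> //|xy]; apply: dcl yS.
Qed.

Lemma card_perm_lt (n : nat) (s : 'S_n) (x : 'I_n) :
  #|[set y : 'I_n | s y < s x]%SET| = s x.
Proof.
rewrite -[RHS](card_ord_lt (ltnW (ltn_ord (s x)))).
rewrite -[LHS](card_imset _ (@perm_inj _ s)); apply: eq_card => z.
rewrite inE; apply/imsetP/idP => [[y + ->]|zx]; first by rewrite inE.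
by exists (s^-1 z)%g; rewrite ?inE permKV.
Qed.

(* Sorting positions by which side of the descent of [s] they lie on, and their
   values by which side of the descent of [s^-1], [s x] can be computed as the
   number of positions [y] with [s y < s x]. *)
Lemma bigrassmannian_blk (n : nat) (s : 'S_n) : s \in bigrassmannian n ->
  exists a p q, [/\ 0 < p, 0 < q, a + p + q <= n & s = blk n a p q].
Proof.
rewrite inE => /andP[/cards1P[d sd] /cards1P[e se]].
have pos_homo := one_descent_homo sd.
(* The same monotonicity for the inverse, whose positions are the values of [s]. *)
have val_homo (x y : 'I_n) : s x < s y -> (s x <= e) = (s y <= e) -> x < y.
  by move=> xy /(one_descent_homo se xy); rewrite !permK.
have inj_s (x y : 'I_n) : s x = s y :> nat -> x = y by move/val_inj/perm_inj.
have lt_s (x y : 'I_n) : x < y -> (s x <= e) = (s y <= e) -> s x < s y.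
  move=> xy exy; case: (ltngtP (s x) (s y)) => // [yx|/inj_s xyE].
    by have := val_homo _ _ yx (esym exy); lia.
  by move: xy; rewrite xyE ltnn.
(* The first letter tells the side of [d] for the position, the second the side of [e] for the
   value. [LL] becomes the initial fixed stretch, [LR] the block of length [q], [RL] the block of
   length [p]. *)
pose LL := [set x : 'I_n | (x <= d) && (s x <= e)]%SET.
pose LR := [set x : 'I_n | (x <= d) && (e < s x)]%SET.
pose RL := [set x : 'I_n | (d < x) && (s x <= e)]%SET.
have LLE : forall x : 'I_n, (x \in LL) = (x < #|LL|).
  apply: down_closed_ord => x y xy; rewrite !inE => /andP[yd ye].
  by have := pos_homo _ _ xy; lia.
have card_L : #|LL| + #|LR| = d.+1.
  rewrite -(card_ord_lt (ltn_ord d)) -cardsUI.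
  have -> : LL :&: LR = finset.set0 by apply/setP => x; rewrite !inE; lia.
  by rewrite cards0 addn0; apply: eq_card => x; rewrite !inE; lia.
have LRLE : forall x : 'I_n,
    (x \in LL :|: LR :|: RL)%SET = (x < #|(LL :|: LR :|: RL)%SET|).
  apply: down_closed_ord => x y xy; rewrite !inE => y_in.
  by have := lt_s _ _ xy; have := pos_homo _ _ xy; lia.
have card_LRL : #|(LL :|: LR :|: RL)%SET| = #|LL| + #|LR| + #|RL|.
  rewrite -cardsUI; have -> : LL :&: LR = finset.set0.
    by apply/setP => x; rewrite !inE; lia.
  rewrite cards0 addn0 -cardsUI.
  have -> : (LL :|: LR) :&: RL = finset.set0.
    by apply/setP => x; rewrite !inE; lia.
  by rewrite cards0 addn0.
have sLL (x : 'I_n) : x \in LL -> s x = x :> nat.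
  rewrite inE => /andP[xd xe]; rewrite -[LHS]card_perm_lt.
  rewrite -[RHS](card_ord_lt (ltnW (ltn_ord x))); apply: eq_card => y.
  rewrite !inE; apply/idP/idP => xy.
    by apply: val_homo => //; lia.
  by apply: pos_homo => //; lia.
have sRR (x : 'I_n) : x \notin LL :|: LR :|: RL -> s x = x :> nat.
  rewrite !inE => x_in; rewrite -[LHS]card_perm_lt.
  rewrite -[RHS](card_ord_lt (ltnW (ltn_ord x))); apply: eq_card => y.
  rewrite !inE; apply/idP/idP => xy.
    case: (ltngtP y x) => // [yx|/val_inj yxE]; last by move: xy; rewrite yxE ltnn.
    by have := pos_homo _ _ yx; lia.
  case: (ltngtP (s y) (s x)) => // [yx|/inj_s yxE]; last by move: xy; rewrite yxE ltnn.
  by have := val_homo _ _ yx; lia.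
(* The values below [s x] sit at the positions before [x] and at all of [RL]. *)
have sLR (x : 'I_n) : x \in LR -> s x = x + #|RL| :> nat.
  rewrite inE => /andP[xd xe]; rewrite -[LHS]card_perm_lt.
  rewrite -[X in X + _](card_ord_lt (ltnW (ltn_ord x))) -cardsUI.
  have -> : [set y : 'I_n | y < x]%SET :&: RL = finset.set0.
    by apply/setP => y; rewrite !inE; lia.
  rewrite cards0 addn0; apply: eq_card => y; rewrite !inE.
  case: (ltngtP y x) => [yx|xy|/val_inj yxE]; last by rewrite yxE; lia.
    by have := pos_homo _ _ yx; lia.
  by have := pos_homo _ _ xy; have := val_homo y x; lia.
(* The positions before [x] are those with a value below [s x], together with all of [LR]. *)
have sRL (x : 'I_n) : x \in RL -> s x + #|LR| = x :> nat.
  rewrite inE => /andP[xd xe]; rewrite -[X in X + _]card_perm_lt -cardsUI.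
  have -> : [set y : 'I_n | s y < s x]%SET :&: LR = finset.set0.
    by apply/setP => y; rewrite !inE; lia.
  rewrite cards0 addn0 -[RHS](card_ord_lt (ltnW (ltn_ord x))).
  apply: eq_card => y; rewrite !inE.
  case: (ltngtP y x) => [yx|xy|/val_inj yxE]; last by rewrite yxE; lia.
    by have := lt_s _ _ yx; have := pos_homo _ _ yx; lia.
  by have := pos_homo _ _ xy; lia.
have le_n : #|LL| + #|RL| + #|LR| <= n.
  by rewrite addnAC -card_LRL -[leqRHS]card_ord max_card.
(* The two entries at the descent lie on different sides of [e], since otherwise [val_homo] would
   put [d'] before [d]. Hence [LR] and [RL] are nonempty. *)
have /existsP[d' /andP[/eqP d'E lt_d']] :
    [exists j : 'I_n, (j == d.+1 :> nat) && (s j < s d)].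
  by have : d \in descents s; [rewrite sd finset.set11 | rewrite inE].
have e_d : e < s d by have := val_homo _ _ lt_d'; lia.
have d'_e : s d' <= e by have := val_homo _ _ lt_d'; lia.
exists #|LL|, #|RL|, #|LR|; split=> //.
- by apply/card_gt0P; exists d'; rewrite inE; lia.
- by apply/card_gt0P; exists d; rewrite inE; lia.
apply/permP => x; apply: ord_inj; rewrite blkE // /swap_blocks.
rewrite -LLE card_L ltnS; case: ifPn => [/sLL // | xNLL].
case: ifPn => [xd | xNd].
  by apply: sLR; move: xNLL; rewrite !inE; lia.
rewrite -card_L -card_LRL -LRLE; case: ifPn => [x_in | /sRR //].
rewrite -(sRL x) ?addnK //; move: x_in xNLL; rewrite !inE; lia.
Qed.

(** * Bruhat comparisons between block exchanges *)

(* The small entry [s j] travels left, one adjacent transposition at a time. *)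
Lemma bruhat_le_move_left (n : nat) (s t : 'S_n) (i j : 'I_n) :
  i <= j -> (forall k : 'I_n, i <= k < j -> s j < s k) ->
  t i = s j -> (forall k k' : 'I_n, i <= k < j -> k' = k.+1 :> nat -> t k' = s k) ->
  (forall k : 'I_n, ~~ (i <= k <= j) -> t k = s k) ->
  bruhat_le t s.
Proof.
case: j => j /=; elim: j s => [|j IHj] s j_n ij lt_s ti tk tE.
  have i0 : i = Ordinal j_n by apply: ord_inj => /=; lia.
  suff -> : t = s by apply: connect0.
  apply/permP => k; case: (eqVneq k i) => [->|ki]; first by rewrite ti -i0.
  by apply: tE => /=; move: ki; rewrite -val_eqE i0 /=; lia.
have j_n' : j < n by lia.
set x := Ordinal j_n'; set y := Ordinal j_n in ti lt_s *.
case: (ltnP j i) => [ji|ij'].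
  have iy : i = y by apply: ord_inj => /=; lia.
  suff -> : t = s by apply: connect0.
  apply/permP => k; case: (eqVneq k i) => [->|ki]; first by rewrite ti iy.
  by apply: tE => /=; move: ki; rewrite -val_eqE iy /=; lia.
have xy : x != y by rewrite -val_eqE /=; lia.
(* One reduction moves the small entry a place to the left; the hypotheses then hold for [s'] with
   [j] in place of [j.+1]. *)
pose s' := (tperm x y * s)%g.
have s'x : s' x = s y by rewrite permM tpermL.
have s'y : s' y = s x by rewrite permM tpermR.
have s'E (k : 'I_n) : k != j :> nat -> k != j.+1 :> nat -> s' k = s k.
  by move=> kj kj'; rewrite permM tpermD // -val_eqE /= eq_sym.
have red : reduction s s'.
  apply/existsP; exists x; apply/existsP; exists y; rewrite eqxx andbT /= leqnn.
  by apply: lt_s => /=; lia.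
apply: connect_trans (connect1 red) _.
apply: (IHj s' j_n') => //=.
- move=> k /andP[ik kj]; rewrite s'x s'E; try lia.
  by apply: lt_s => /=; lia.
- by rewrite ti -s'x.
- move=> k k' /andP[ik kj] k'E; rewrite s'E; try lia.
  by apply: tk => //=; lia.
- move=> k k_out; case: (eqVneq (k : nat) j.+1) => kj.
    have -> : k = y by apply: ord_inj.
    by rewrite s'y; apply: tk => //=; lia.
  rewrite s'E //; last by lia.
  by apply: tE => /=; lia.
Qed.

(** The smallest exchanged entry, [a], stands at position [a + q]; it travels left past the [q]
    larger entries to position [a] and becomes fixed. *)
Lemma blk_le_small (n a p q : nat) : a + p.+1 + q <= n ->
  bruhat_le (blk n a.+1 p q) (blk n a p.+1 q).
Proof.
move=> le_n; have a_n : a < n by lia. have aq_n : a + q < n by lia.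
have le_n' : a.+1 + p + q <= n by lia.
have f (x : 'I_n) := blkE x le_n; have g (x : 'I_n) := blkE x le_n'.
apply: (@bruhat_le_move_left _ _ _ (Ordinal a_n) (Ordinal aq_n)) => /=.
- lia.
- move=> k k_in; rewrite !f /= swap_blocksB ?swap_blocksD; lia.
- by apply: ord_inj; rewrite f g /= swap_blocks_lt ?swap_blocksB; lia.
- move=> k k' k_in k'E; apply: ord_inj.
  by rewrite f g /= !swap_blocksD; lia.
- move=> k k_out; apply: ord_inj; rewrite f g /swap_blocks.
  by do !case: ifP; lia.
Qed.

(** Positions [i < j] with [s j < s i] are an inversion of [s]; read in the inverse, the same pair
    is the inversion at positions [s j < s i]. *)
Lemma reductionV (n : nat) (s t : 'S_n) :
  reduction s t -> reduction s^-1%g t^-1%g.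
Proof.
case/existsP=> i /existsP[j /and3P[ij sji /eqP ->]].
apply/existsP; exists (s j); apply/existsP; exists (s i).
rewrite !permK ij sji /= invMg tpermV.
by apply/eqP; rewrite [tperm (s j) _]tpermC -tpermJ conjgE !mulgA mulgK.
Qed.

Lemma bruhat_leV (n : nat) (s t : 'S_n) :
  bruhat_le s t -> bruhat_le s^-1%g t^-1%g.
Proof.
rewrite /bruhat_le => /connectP[l].
elim: l t => [|u l IHl] t /=; first by move=> _ ->; apply: connect0.
case/andP=> /reductionV tu ul sE.
exact: connect_trans (connect1 tu) (IHl _ ul sE).
Qed.

(** Inversion preserves the order and exchanges [p] and [q], which turns this into
    [blk_le_small]. *)
Lemma blk_le_big (n a p q : nat) : a + p + q.+1 <= n ->
  bruhat_le (blk n a.+1 p q) (blk n a p q.+1).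
Proof.
move=> le_n; rewrite -[blk n a p _]invgK -[blk n a.+1 _ _]invgK.
by apply: bruhat_leV; rewrite !blkV; [apply: blk_le_small; lia | lia | lia].
Qed.

(** The longest element. Conjugation by it preserves the Bruhat order and reads a block exchange
    from the other end, so that the two fixed stretches trade places. *)
Definition rev_perm (n : nat) : 'S_n := perm (@rev_ord_inj n).

Lemma rev_permK (n : nat) : (rev_perm n * rev_perm n = 1)%g.
Proof. by apply/permP => x; rewrite permM !permE rev_ordK. Qed.

Lemma rev_permV (n : nat) : ((rev_perm n)^-1 = rev_perm n)%g.
Proof. by rewrite -[LHS]mulg1 -(rev_permK n) mulKg. Qed.

Lemma reduction_rev (n : nat) (s t : 'S_n) : reduction s t ->
  reduction (rev_perm n * s * rev_perm n)%g (rev_perm n * t * rev_perm n)%g.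
Proof.
have rK (x : 'I_n) : rev_perm n (rev_perm n x) = x by rewrite -permM rev_permK perm1.
case/existsP=> i /existsP[j /and3P[ij sji /eqP ->]].
apply/existsP; exists (rev_perm n j); apply/existsP; exists (rev_perm n i).
rewrite !permM !rK; apply/and3P; split.
- by rewrite !permE /=; have := ltn_ord j; lia.
- by rewrite !permE /=; have := ltn_ord (s i); lia.
apply/eqP; rewrite tpermC -tpermJ conjgE rev_permV !mulgA.
by rewrite -[(_ * rev_perm n * rev_perm n)%g]mulgA rev_permK mulg1.
Qed.

Lemma bruhat_le_rev (n : nat) (s t : 'S_n) : bruhat_le s t ->
  bruhat_le (rev_perm n * s * rev_perm n)%g (rev_perm n * t * rev_perm n)%g.
Proof.
rewrite /bruhat_le => /connectP[l].
elim: l t => [|u l IHl] t /=; first by move=> _ ->; apply: connect0.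
case/andP=> /reduction_rev tu ul sE.
exact: connect_trans (connect1 tu) (IHl _ ul sE).
Qed.

Lemma blk_rev (n a p q : nat) : a + p + q <= n ->
  (rev_perm n * blk n (n - (a + p + q)) q p * rev_perm n)%g = blk n a p q.
Proof.
move=> le_n; apply/permP => x; apply: ord_inj.
rewrite 2!permM /rev_perm permE /= blkE; last by lia.
rewrite blkE // permE /= /swap_blocks; have := ltn_ord x.
by do !case: ifP; lia.
Qed.

(** Mirror image of [blk_le_small]: the largest exchanged entry travels right to the end of the
    blocks and becomes fixed. *)
Lemma blk_le_top (n a p q : nat) : a + p + q.+1 <= n ->
  bruhat_le (blk n a p q) (blk n a p q.+1).
Proof.
move=> le_n; rewrite -[blk n a p q]blk_rev; last by lia.
rewrite -[blk n a p q.+1]blk_rev; last by lia.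
apply: bruhat_le_rev; set r := n - (a + p + q.+1).
have -> : n - (a + p + q) = r.+1 by lia.
by apply: blk_le_small; lia.
Qed.

Lemma blk_le_bottom (n a p q : nat) : a + p.+1 + q <= n ->
  bruhat_le (blk n a p q) (blk n a p.+1 q).
Proof.
move=> le_n; rewrite -[blk n a p _]invgK -[blk n a p.+1 _]invgK.
by apply: bruhat_leV; rewrite !blkV; [apply: blk_le_top; lia | lia | lia].
Qed.

(** One unit at a time: [i] is handled by [blk_le_small], [j] by [blk_le_bottom], [k] by
    [blk_le_big]. Three free parameters are what makes the families below cubic. *)
Lemma blk_le (n a p q i j k : nat) : a + (p + i + j) + (q + k) <= n ->
  bruhat_le (blk n (a + i + k) p q) (blk n a (p + i + j) (q + k)).
Proof.
have trans := @connect_trans _ (@reduction n).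
elim: i a => [|i IHi] a le_n.
  elim: j le_n => [|j IHj] le_n.
    elim: k a le_n => [|k IHk] a le_n; first by rewrite !addn0; apply: connect0.
    have -> : a + 0 + k.+1 = a.+1 + 0 + k by lia.
    rewrite [q + _]addnS; apply: trans (IHk a.+1 _); last by lia.
    by apply: blk_le_big; lia.
  rewrite [p + 0 + _]addnS; apply: trans (IHj _); last by lia.
  by apply: blk_le_bottom; lia.
have -> : a + i.+1 + k = a.+1 + i + k by lia.
have -> : p + i.+1 + j = (p + i + j).+1 by lia.
apply: trans (IHi a.+1 _); last by lia.
by apply: blk_le_small; lia.
Qed.

(** * Cubic bounds on the counts *)

Lemma cube_le_card (m : nat) (T : finType) (A : {set T})
    (f : 'I_m * 'I_m * 'I_m -> T) :
  injective f -> (forall t, f t \in A) -> m ^ 3 <= #|A|.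
Proof.
move=> f_inj fA.
have <- : #|f @: [set: 'I_m * 'I_m * 'I_m]| = m ^ 3.
  by rewrite card_imset // cardsT !card_prod card_ord; lia.
by apply/subset_leq_card/fintype.subsetP => _ /imsetP[t _ ->].
Qed.

(** Apply [blk_le] with [i], [j], [k] below [m]: the block of length [p] loses [i + j] and the other
    loses [k], so both stay nonempty. The new lengths determine [k], then [i], then [j]. *)
Lemma beta_blk_ge (n m a p q : nat) : a + p + q <= n -> m.*2 <= p -> m <= q ->
  m ^ 3 <= beta (blk n a p q).
Proof.
move=> le_n le_p le_q.
apply: (@cube_le_card _ _ _ (fun t : 'I_m * 'I_m * 'I_m =>
  blk n (a + t.1.1 + t.2) (p - t.1.1 - t.1.2) (q - t.2))).
  move=> [[i j] k] [[i' j'] k'] /= /blk_inj.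
  have := (ltn_ord i, ltn_ord j, ltn_ord k, (ltn_ord i', ltn_ord j', ltn_ord k')).
  move=> [[[? ?] ?] [[? ?] ?]] [||||||? ? ?]; try lia.
  by congr (_, _, _); apply: ord_inj; lia.
move=> [[i j] k] /=; have := (ltn_ord i, ltn_ord j, ltn_ord k) => -[[i_m j_m] k_m].
rewrite inE blk_bigrassmannian /=; try lia.
have := @blk_le n a (p - i - j) (q - k) i j k.
have -> : p - i - j + i + j = p by lia.
have -> : q - k + k = q by lia.
by apply.
Qed.

(** Here the blocks grow: the initial fixed stretch gives up [i + k], less than [m.*2] in all, and
    the final one gives up [j]. *)
Lemma alpha_blk_ge (n m a p q : nat) : 0 < p -> 0 < q -> a + p + q + m <= n ->
  m.*2 <= a -> m ^ 3 <= alpha (blk n a p q).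
Proof.
move=> p0 q0 le_n le_a.
apply: (@cube_le_card _ _ _ (fun t : 'I_m * 'I_m * 'I_m =>
  blk n (a - t.1.1 - t.2) (p + t.1.1 + t.1.2) (q + t.2))).
  move=> [[i j] k] [[i' j'] k'] /= /blk_inj.
  have := (ltn_ord i, ltn_ord j, ltn_ord k, (ltn_ord i', ltn_ord j', ltn_ord k')).
  move=> [[[? ?] ?] [[? ?] ?]] [||||||? ? ?]; try lia.
  by congr (_, _, _); apply: ord_inj; lia.
move=> [[i j] k] /=; have := (ltn_ord i, ltn_ord j, ltn_ord k) => -[[i_m j_m] k_m].
rewrite inE blk_bigrassmannian /=; try lia.
have := @blk_le n (a - i - k) p q i j k.
have -> : a - i - k + i + k = a by lia.
by apply; lia.
Qed.

Lemma card_bigrassmannian_ge (n m : nat) :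
  3 * m <= n -> m ^ 3 <= #|bigrassmannian n|.
Proof.
move=> le_n; apply: (@cube_le_card _ _ _ (fun t : 'I_m * 'I_m * 'I_m =>
  blk n t.1.1 t.1.2.+1 t.2.+1)).
  move=> [[i j] k] [[i' j'] k'] /= /blk_inj.
  have := (ltn_ord i, ltn_ord j, ltn_ord k, (ltn_ord i', ltn_ord j', ltn_ord k')).
  move=> [[[? ?] ?] [[? ?] ?]] [||||||? ? ?]; try lia.
  by congr (_, _, _); apply: ord_inj; lia.
move=> [[i j] k] /=; have := (ltn_ord i, ltn_ord j, ltn_ord k) => -[[i_m j_m] k_m].
by apply: blk_bigrassmannian; lia.
Qed.

Lemma card_bigrassmannian_gt0 (n : nat) : 3 <= n -> 0 < #|bigrassmannian n|.
Proof. exact: (@card_bigrassmannian_ge n 1). Qed.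

Lemma card_bigrassmannian_le (n : nat) : #|bigrassmannian n| <= n ^ 3.
Proof.
pose f (t : 'I_n * 'I_n * 'I_n) := blk n t.1.1 t.1.2.+1 t.2.+1.
have -> : n ^ 3 = #|{: 'I_n * 'I_n * 'I_n}| by rewrite !card_prod card_ord; lia.
apply: leq_trans (leq_imset_card f predT); apply/subset_leq_card/fintype.subsetP => s.
case/bigrassmannian_blk => a [p [q [p0 q0 le_n ->]]]; apply/imsetP.
have a_n : a < n by lia. have p_n : p.-1 < n by lia. have q_n : q.-1 < n by lia.
by exists (Ordinal a_n, Ordinal p_n, Ordinal q_n); rewrite // /f /= !prednK.
Qed.

Lemma alpha_le (n : nat) (w : 'S_n) : alpha w <= n ^ 3.
Proof.
apply: leq_trans (card_bigrassmannian_le n); apply: subset_leq_card.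
by apply/fintype.subsetP => t; rewrite inE => /andP[].
Qed.

Lemma beta_le (n : nat) (w : 'S_n) : beta w <= n ^ 3.
Proof.
apply: leq_trans (card_bigrassmannian_le n); apply: subset_leq_card.
by apply/fintype.subsetP => t; rewrite inE => /andP[].
Qed.

(** * Few permutations have a short block *)

Lemma card_last_lt_le (n k : nat) :
  #|[set t : 'I_n * 'I_n * 'I_n | t.2 < k]%SET| <= k * n ^ 2.
Proof.
have -> : [set t : 'I_n * 'I_n * 'I_n | t.2 < k]%SET
        = finset.setX [set: 'I_n * 'I_n]%SET [set z : 'I_n | z < k]%SET.
  by apply/setP => t; rewrite !inE.
rewrite cardsX cardsT card_prod card_ord mulnC mulnn leq_mul2r; apply/orP; right.
have [le_nk|lt_kn] := leqP n k; last by rewrite card_ord_lt // ltnW.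
by rewrite (leq_trans (max_card _)) // card_ord.
Qed.

(* A bigrassmannian permutation with few elements above or below it has a short
   block: one of the two exchanged ones, or one of the two fixed ones. *)
Lemma card_bad_le (n m : nat) :
  #|[set w in bigrassmannian n | ~~ ((m ^ 3 <= alpha w) && (m ^ 3 <= beta w))]%SET|
    <= 8 * m * n ^ 2.
Proof.
pose S := [set t : 'I_n * 'I_n * 'I_n | t.2 < m.*2]%SET.
(* The last coordinate encodes the short length, less one for [p] and [q], which are positive. In
   [f4] it is the final fixed length, from which [q] is recovered. Four images of at most
   [m.*2 * n ^ 2] elements give the factor 8. *)
pose f1 (t : 'I_n * 'I_n * 'I_n) := blk n t.2 t.1.1.+1 t.1.2.+1.
pose f2 (t : 'I_n * 'I_n * 'I_n) := blk n t.1.1 t.2.+1 t.1.2.+1.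
pose f3 (t : 'I_n * 'I_n * 'I_n) := blk n t.1.1 t.1.2.+1 t.2.+1.
pose f4 (t : 'I_n * 'I_n * 'I_n) :=
  blk n t.1.1 t.1.2.+1 (n - t.1.1 - t.1.2.+1 - t.2).
apply: (@leq_trans #|(f1 @: S :|: f2 @: S :|: f3 @: S :|: f4 @: S)%SET|); last first.
  have card_f (f : 'I_n * 'I_n * 'I_n -> 'S_n) : #|(f @: S)%SET| <= m.*2 * n ^ 2.
    exact: leq_trans (leq_imset_card _ _) (card_last_lt_le _ _).
  have := @card_f f1; have := @card_f f2; have := @card_f f3; have := @card_f f4.
  have := (leq_card_setU (f1 @: S :|: f2 @: S :|: f3 @: S)%SET (f4 @: S)%SET).1.
  have := (leq_card_setU (f1 @: S :|: f2 @: S)%SET (f3 @: S)%SET).1.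
  have := (leq_card_setU (f1 @: S)%SET (f2 @: S)%SET).1.
  lia.
apply/subset_leq_card/fintype.subsetP => w; rewrite inE => /andP[].
case/bigrassmannian_blk => a [p [q [p0 q0 le_n ->]]] bad; rewrite !finset.inE.
have a_n : a < n by lia. have p_n : p.-1 < n by lia. have q_n : q.-1 < n by lia.
have [a_small|a_m] := ltnP a m.*2.
  suff -> : blk n a p q \in f1 @: S by [].
  apply/imsetP; exists (Ordinal p_n, Ordinal q_n, Ordinal a_n).
    by rewrite inE.
  by rewrite /f1 /= !prednK.
have [p_small|p_m] := ltnP p m.*2.
  suff -> : blk n a p q \in f2 @: S by rewrite !orbT.
  apply/imsetP; exists (Ordinal a_n, Ordinal q_n, Ordinal p_n).
    by rewrite inE /=; lia.
  by rewrite /f2 /= !prednK.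
have [q_small|q_m] := ltnP q m.*2.
  suff -> : blk n a p q \in f3 @: S by rewrite !orbT.
  apply/imsetP; exists (Ordinal a_n, Ordinal p_n, Ordinal q_n).
    by rewrite inE /=; lia.
  by rewrite /f3 /= !prednK.
have [r_small|r_m] := ltnP (n - (a + p + q)) m.*2.
  have r_n : n - (a + p + q) < n by lia.
  suff -> : blk n a p q \in f4 @: S by rewrite !orbT.
  apply/imsetP; exists (Ordinal a_n, Ordinal p_n, Ordinal r_n).
    by rewrite inE /=; lia.
  by rewrite /f4 /= prednK //; congr blk; lia.
by case/negP: bad; rewrite alpha_blk_ge ?beta_blk_ge //; lia.
Qed.

(** The left side is at most [8 * n ^ 3], and there are at least [(n %/ 6) ^ 3] bigrassmannian
    permutations, where [n <= 12 * (n %/ 6)] once [6 <= n]. *)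
Lemma card_bad_ratio (n K : nat) : 6 <= n ->
  K * #|[set w in bigrassmannian n |
          ~~ (((n %/ K) ^ 3 <= alpha w) && ((n %/ K) ^ 3 <= beta w))]%SET|
    <= 8 * 12 ^ 3 * #|bigrassmannian n|.
Proof.
move=> n6.
have m_n : 3 * (n %/ 6) <= n by lia.
apply: leq_trans (leq_mul (leqnn K) (card_bad_le n (n %/ K))) _.
apply: (@leq_trans (8 * n ^ 3)).
  have := leq_trunc_div n K.
  rewrite (_ : K * _ = 8 * (n %/ K * K * n ^ 2)); last by ring.
  by move=> le_n; rewrite leq_mul2l expnS leq_mul2r le_n orbT.
rewrite -mulnA leq_mul2l /= (leq_trans _ (leq_mul (leqnn _) (card_bigrassmannian_ge m_n))) //.
rewrite -expnMn leq_exp2r //; lia.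
Qed.

(** * Probabilities and the limit *)

Local Open Scope classical_set_scope.
Local Open Scope ring_scope.

Lemma uniform_onC (R : realType) (T : finType) (A : {set T}) (E : pred T) :
  (0 < #|A|)%N -> 1 - uniform_on R A E = uniform_on R A (fun x => ~~ E x).
Proof.
move=> A0; have A_neq0 : #|A|%:R != 0 :> R by rewrite pnatr_eq0 -lt0n.
rewrite /uniform_on -{1}(divff A_neq0) -mulrBl; congr (_ / _).
apply/eqP; rewrite subr_eq -natrD eqr_nat; apply/eqP.
rewrite -[LHS](cardsID [set x | E x]%SET) addnC; congr (_ + _)%N; apply: eq_card => x.
  by rewrite !inE andbC.
by rewrite !inE.
Qed.

(** The upper bounds always hold, as [1 <= c]. The lower bounds follow from [(n %/ K) ^ 3] being
    one, so a failure is counted by [card_bad_ratio]. *)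
Lemma uniform_on_bad_le (R : realType) (n K : nat) (c : R) :
    (0 < K)%N -> (6 <= n)%N -> (K <= n)%N -> 8 * K%:R ^+ 3 <= c ->
  uniform_on R (bigrassmannian n) (fun w : 'S_n =>
      ~~ ((n%:R ^+ 3 / c <= (alpha w)%:R <= c * n%:R ^+ 3) &&
          (n%:R ^+ 3 / c <= (beta w)%:R <= c * n%:R ^+ 3)))
    <= (8 * 12 ^ 3)%N%:R / K%:R.
Proof.
move=> K0 n6 le_Kn le_c.
have K1 : 1 <= K%:R ^+ 3 :> R by rewrite -natrX ler1n expn_gt0 K0.
have c1 : 1 <= c by lra.
have c0 : 0 < c by lra.
have upper (k : nat) : (k <= n ^ 3)%N -> k%:R <= c * n%:R ^+ 3.
  by move=> le_k; rewrite -natrX (le_trans _ (ler_peMl _ c1)) // ler_nat.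
have lower (k : nat) : ((n %/ K) ^ 3 <= k)%N -> n%:R ^+ 3 / c <= k%:R.
  move=> le_k; rewrite ler_pdivrMr //.
  (* [K <= n] makes the quotient positive, so rounding down loses at most a factor 2; its cube is
     the 8 in the condition on [c]. *)
  have le_n : (n <= 2 * K * (n %/ K))%N.
    have := ltn_ceil n K0; have : (0 < n %/ K)%N by rewrite divn_gt0.
    by nia.
  have le_n3 : n%:R ^+ 3 <= 8 * K%:R ^+ 3 * k%:R :> R.
    rewrite -!natrX -!natrM ler_nat; apply: (@leq_trans ((2 * K * (n %/ K)) ^ 3)).
      by rewrite leq_exp2r.
    by rewrite !expnMn leq_mul2l le_k orbT.
  by rewrite (le_trans le_n3) // mulrC ler_wpM2l.
have B0 : (0 < #|bigrassmannian n|)%N by apply: card_bigrassmannian_gt0; lia.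
rewrite /uniform_on ler_pdivrMr ?ltr0n // [leRHS]mulrAC.
rewrite ler_pdivlMr ?ltr0n // -!natrM ler_nat.
rewrite mulnC (leq_trans _ (card_bad_ratio K n6)) // leq_mul2l subset_leq_card ?orbT //.
apply/fintype.subsetP => w; rewrite !inE => /andP[-> /=]; apply: contra.
by case/andP => *; rewrite !lower ?upper ?alpha_le ?beta_le.
Qed.

Theorem theorem4p6 (R : realType) (h : nat -> R)
    (h_gt0 : forall n : nat, 0 < h n)
    (h_oo : h n @[n --> \oo] --> +oo) :
  uniform_on R (bigrassmannian n) (fun w : 'S_n =>
      (n%:R ^+ 3 / h n <= (alpha w)%:R <= h n * n%:R ^+ 3) &&
      (n%:R ^+ 3 / h n <= (beta w)%:R <= h n * n%:R ^+ 3))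
    @[n --> \oo] --> (1 : R).
Proof.
apply/cvgrPdist_le => e e0.
(* Chosen so that the bound [8 * 12 ^ 3 / K] falls below [e]. *)
pose K := (Num.truncn ((8 * 12 ^ 3)%N%:R / e)).+1.
near=> n.
have n6 : (6 <= n)%N by near: n; exact: nbhs_infty_ge.
have nK : (K <= n)%N by near: n; exact: nbhs_infty_ge.
have hK : 8 * K%:R ^+ 3 <= h n by near: n; move/cvgryPge : h_oo; apply.
have B0 : (0 < #|bigrassmannian n|)%N by apply: card_bigrassmannian_gt0; lia.
rewrite uniform_onC // ger0_norm ?divr_ge0 //.
rewrite (le_trans (uniform_on_bad_le _ n6 nK hK)) //.
by rewrite ler_pdivrMr ?ltr0n // mulrC -ler_pdivrMr // ltW // truncnS_gt.
Unshelve. all: by end_near.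
Qed.
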